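(* Let $K$ be an arbitrary field, let $h(t,z)\in K\langle t,z\rangle$, and suppose that $\deg_t h(t,z)>0$. Then the $z$-endomorphism $$\sigma_h=(x+zh(xz-zy,z),\ y+h(xz-zy,z)z)$$ of $K\langle x,y,z\rangle$ (mapping $x\mapsto x+zh(xz-zy,z)$, $y\mapsto y+h(xz-zy,z)z$, $z\mapsto z$) is a $z$-wild automorphism of $K\langle x,y,z\rangle$.
   Context: $K\langle t,z\rangle$ and $K\langle x,y,z\rangle$ are the free associative (unital) $K$-algebras freely generated by the indicated variables. A $z$-endomorphism (respectively $z$-automorphism) is a $K$-algebra endomorphism (respectively automorphism) $\varphi$ of $K\langle x,y,z\rangle$ with $\varphi(z)=z$; it is written $\varphi=(f,g)$ with $f=\varphi(x)$, $g=\varphi(y)$. The $z$-affine automorphisms are those of the form $(\alpha_{11}x+\alpha_{21}y+\alpha_{31}z+\beta_1,\ \alpha_{12}x+\alpha_{22}y+\alpha_{32}z+\beta_2)$ with $\alpha_{ij},\beta_j\in K$ and the $2\times 2$ matrix $(\alpha_{ij})_{i,j=1,2}$ invertible. The $z$-triangular automorphisms are those of the form $(\alpha_1x+p_1(y,z),\ \alpha_2y+p_2(z))$ with $\alpha_1,\alpha_2\in K^{\ast}=K\setminus\{0\}$, $p_1\in K\langle y,z\rangle$, $p_2\in K[z]$. A $z$-automorphism is $z$-tame if it belongs to the group generated by the $z$-affine and the $z$-triangular automorphisms (under composition), and $z$-wild otherwise. *)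

(* Defs.v *)
From HB Require Import structures.
From mathcomp Require Import all_boot all_algebra.
From mathcomp Require Import finmap.
From mathcomp Require Import monalg.

Set Implicit Arguments.
Unset Strict Implicit.
Unset Printing Implicit Defensive.

Import GRing.Theory.
Local Open Scope ring_scope.

(* The free associative unital K-algebra on n generators, realized as the
   monoid algebra over K of the free monoid of words over 'I_n. *)
Notation freeAlg K n := {malg K[{fmonom 'I_n}]}.

Section FreeAlgebra.
Context {K : fieldType}.

Definition genvar {n : nat} (i : 'I_n) : freeAlg K n := << fmu i >>.

(* The degree of p in the variable i: the maximal number of letters i in a word
   occurring in p (0 when p = 0). *)
Definition deg_in {n : nat} (i : 'I_n) (p : freeAlg K n) : nat :=
  (\max_(w <- msupp p) count_mem i (w : seq 'I_n))%N.

Definition word_eval {m n : nat} (s : m.-tuple (freeAlg K n))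
    (w : {fmonom 'I_m}) : freeAlg K n :=
  \prod_(i <- (w : seq 'I_m)) tnth s i.

(* p(s_0, ..., s_(m-1)) *)
Definition subst {m n : nat} (s : m.-tuple (freeAlg K n))
    (p : freeAlg K m) : freeAlg K n :=
  mmap (@malgC {fmonom 'I_n} K) (word_eval s) p.

Lemma malgC_comm n (c : K) (p : freeAlg K n) : GRing.comm c%:MP p.
Proof.
rewrite /GRing.comm [p in LHS]monalgE [p in RHS]monalgE mulr_sumr mulr_suml.
apply: eq_bigr => w _; rewrite !malgM_def !fgmulUU mulrC.
by congr << _ *g _ >>; rewrite mul1m mulm1.
Qed.

Section SubstMorphism.
Variables (m n : nat) (s : m.-tuple (freeAlg K n)).

Lemma word_eval_mmorphism : mmorphism (word_eval s).
Proof.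
split=> [u v|]; first by rewrite /word_eval fmM big_cat.
by rewrite /word_eval fm1 big_nil.
Qed.

HB.instance Definition _ :=
  monalg.isMultiplicative.Build _ _ (word_eval s) word_eval_mmorphism.

Lemma subst_is_zmod_morphism : zmod_morphism (subst s).
Proof. exact: mmap_is_additive. Qed.

Lemma subst_is_monoid_morphism : monoid_morphism (subst s).
Proof.
by split; apply commr_mmap_is_multiplicative => g u v; apply: malgC_comm.
Qed.

Lemma subst_is_scalable : scalable (subst s).
Proof. by move=> c p; rewrite /subst mmapZ mul_malgC. Qed.

HB.instance Definition _ := Algebra.isZmodMorphism.Build
  (freeAlg K m) (freeAlg K n) (subst s) subst_is_zmod_morphism.
HB.instance Definition _ := GRing.isMonoidMorphism.Build
  (freeAlg K m) (freeAlg K n) (subst s) subst_is_monoid_morphism.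
HB.instance Definition _ := GRing.isScalable.Build
  K (freeAlg K m) (freeAlg K n) *:%R (subst s) subst_is_scalable.

Lemma subst_genvar (i : 'I_m) : subst s (genvar i) = tnth s i.
Proof.
by rewrite /subst /genvar mmapU mul_malgC scale1r /word_eval fmU big_seq1.
Qed.

End SubstMorphism.

End FreeAlgebra.

Section ZAutomorphisms.
Context {K : fieldType}.
Local Notation A := (freeAlg K 3).
Local Notation endo := {lrmorphism A -> A}.

Definition vx : A := genvar 0.
Definition vy : A := genvar 1.
Definition vz : A := genvar 2.

(* The z-endomorphism (f, g) : x |-> f, y |-> g, z |-> z. *)
Definition z_endo (f g : A) : endo := subst [tuple f; g; vz].

Definition is_z_endo (phi : endo) : Prop := phi vz = vz.

Definition is_z_auto (phi : endo) : Prop := is_z_endo phi /\ bijective phi.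

(* a is the 2x2 matrix (alpha_ij), c the row (alpha_31, alpha_32). *)
Definition z_affine_map (a : 'M[K]_2) (c b : 'rV[K]_2) : endo :=
  z_endo (a 0 0 *: vx + a 1 0 *: vy + c 0 0 *: vz + (b 0 0)%:A)
         (a 0 1 *: vx + a 1 1 *: vy + c 0 1 *: vz + (b 0 1)%:A).

Definition z_triangular_map (a1 a2 : K) (p1 : freeAlg K 2) (p2 : {poly K}) :
    endo :=
  z_endo (a1 *: vx + subst [tuple vy; vz] p1)
         (a2 *: vy + (map_poly (in_alg A) p2).[vz]).

(* The group under composition generated by the z-affine and the z-triangular
   automorphisms. Bundled morphisms that agree pointwise need not be equal as
   terms, hence [z_tame_ext]. *)
Inductive z_tame : endo -> Prop :=
| z_tame_affine a c b : a \in unitmx -> z_tame (z_affine_map a c b)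
| z_tame_triangular a1 a2 p1 p2 :
    a1 != 0 -> a2 != 0 -> z_tame (z_triangular_map a1 a2 p1 p2)
| z_tame_id : z_tame idfun
| z_tame_comp (phi psi : endo) :
    z_tame phi -> z_tame psi -> z_tame (phi \o psi)
| z_tame_inv (phi psi : endo) :
    z_tame phi -> cancel phi psi -> cancel psi phi -> z_tame psi
| z_tame_ext (phi psi : endo) : z_tame phi -> phi =1 psi -> z_tame psi.

Definition z_wild (phi : endo) : Prop := is_z_auto phi /\ ~ z_tame phi.

(* In K<t, z>, t is generator 0 and z is generator 1. *)
Definition deg_t (h : freeAlg K 2) : nat := deg_in 0 h.

Definition sigma (h : freeAlg K 2) : endo :=
  let h' := subst [tuple vx * vz - vz * vy; vz] h in
  z_endo (vx + vz * h') (vy + h' * vz).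

End ZAutomorphisms.

(* Main.v *)
Require Import Defs.
From mathcomp Require Import all_boot all_algebra.
From mathcomp Require Import ssrAC finmap monalg boolp zify ring.

Set Implicit Arguments.
Unset Strict Implicit.
Unset Printing Implicit Defensive.

Import GRing.Theory.
Local Open Scope ring_scope.

(* Put u = xz - zy. Since sigma_h fixes u, its inverse is sigma_(-h).
   For wildness, order words first by the number of letters other than z, then
   by length, then lexicographically with z largest. If the leading word G of g
   contains a letter other than z, then w |-> w(G, z) is injective, so the
   leading word of p(g, z) is the largest w(G, z) with w occurring in p. The
   tame group is the amalgam of an affine and a triangular factor: every tame
   pair (f, g) is reached from (x, y) by strictly alternating affine and
   triangular steps. After a triangular step the leading word of f has larger
   weight (number of letters other than z, then length) than that of g; after an
   affine step the leading word of f is at most that of g, unless no triangular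
   step was made and both leading words are letters. For sigma_h the leading
   words are zH and Hz, where H is the leading word of h(u, z): they have the
   same weight, but zH > Hz, so sigma_h fits neither case. *)

(** * Auxiliary identities: determinants, affine images, shears *)

Lemma det_mx2 (R : comPzRingType) (a : 'M[R]_2) :
  \det a = a 0 0 * a 1 1 - a 1 0 * a 0 1.
Proof.
rewrite (expand_det_col a 0) !big_ord_recl big_ord0 addr0 /cofactor !det_mx11.
rewrite !mxE /= expr0 expr1 mul1r mulN1r mulrN.
by congr (_ * a _ _ - a _ _ * a _ _); apply: val_inj.
Qed.

Lemma lrmorph_affine (R : comNzRingType) (V W : lalgType R)
    (psi : {lrmorphism V -> W}) (s t k l : R) u v w w' : psi w = w' ->
  psi (s *: u + t *: v + k *: w + l%:A) =
    s *: psi u + t *: psi v + (k *: w' + l%:A).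
Proof. by move=> <-; rewrite !linearD !linearZ rmorph1 addrA. Qed.

Section Shear.
Variables (R : pzRingType) (phi : {rmorphism R -> R}) (x y z k : R).

(** The extra terms of [phi (x * z)] and [phi (z * y)] are both [z * k * z] and cancel. *)
Lemma shear_fix : phi x = x + z * k -> phi y = y + k * z -> phi z = z ->
  phi (x * z - z * y) = x * z - z * y.
Proof.
move=> phix phiy phiz; rewrite rmorphB !rmorphM phix phiy phiz.
by rewrite mulrDl mulrDr -mulrA [_ * y + _]addrC opprD addrA addrK.
Qed.

Lemma shear_cancell : phi x = x + z * - k -> phi z = z -> phi k = k ->
  phi (x + z * k) = x.
Proof.
by move=> phix phiz phik; rewrite rmorphD rmorphM phix phiz phik mulrN subrK.
Qed.

Lemma shear_cancelr : phi y = y + - k * z -> phi z = z -> phi k = k ->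
  phi (y + k * z) = y.
Proof.
by move=> phiy phiz phik; rewrite rmorphD rmorphM phiy phiz phik mulNr subrK.
Qed.

End Shear.

Lemma ord2_neq0 (i : 'I_2) : i != 0 -> i = 1.
Proof. by case: i => [[|[|//]] lt] // _; apply: val_inj. Qed.

(** * A monomial order on the words in x, y, z *)

Section WordOrder.
Local Open Scope nat_scope.
Implicit Types (u v w : seq 'I_3) (p q r : seq 'I_2).

Definition nonz w := count (predC1 (2%R : 'I_3)) w.

(* value in base 3: on words of equal length, the lexicographic order with
   x < y < z *)
Definition num w := foldl (fun a (i : 'I_3) => a * 3 + i) 0 w.

Definition wtlt u v :=
  (nonz u < nonz v) || ((nonz u == nonz v) && (size u < size v)).

Definition wlt u v :=
  wtlt u v || [&& nonz u == nonz v, size u == size v & num u < num v].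

Lemma nonz_cat u v : nonz (u ++ v) = nonz u + nonz v.
Proof. exact: count_cat. Qed.

Lemma num_cat u v : num (u ++ v) = num u * 3 ^ size v + num v.
Proof.
rewrite /num foldl_cat; elim/last_ind: v => [|v i IHv] /=.
  by rewrite muln1 addn0.
by rewrite !foldl_rcons IHv size_rcons expnSr; lia.
Qed.

Lemma num_lt u : num u < 3 ^ size u.
Proof.
elim/last_ind: u => [|u i IHu] //.
rewrite /num foldl_rcons size_rcons expnSr -/(num u).
by have := ltn_ord i; lia.
Qed.

Lemma num_inj u v : size u = size v -> num u = num v -> u = v.
Proof.
elim/last_ind: u v => [|u i IHu] v; first by case: v.
case/lastP: v => [|v j]; rewrite !size_rcons // => -[Esz].
rewrite /num !foldl_rcons -!/(num _) => E.
have [li lj] := (ltn_ord i, ltn_ord j).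
have Eij : i = j by apply: val_inj => /=; lia.
by rewrite (IHu v) ?Eij //; lia.
Qed.

Lemma wlt_irr u : wlt u u = false.
Proof. by rewrite /wlt /wtlt; lia. Qed.

Lemma wlt_trans v u w : wlt u v -> wlt v w -> wlt u w.
Proof. by rewrite /wlt /wtlt; lia. Qed.

Lemma wlt_total u v : u != v -> wlt u v || wlt v u.
Proof.
move=> neq; have [Esz|] := eqVneq (size u) (size v); last first.
  by rewrite /wlt /wtlt; lia.
have [En|] := eqVneq (num u) (num v); last by rewrite /wlt /wtlt; lia.
by rewrite (num_inj Esz En) eqxx in neq.
Qed.

Lemma wlt_catl w u v : wlt u v -> wlt (w ++ u) (w ++ v).
Proof.
rewrite /wlt /wtlt !nonz_cat !num_cat !size_cat.
(* In the lexicographic case the lengths agree, so [w] contributes the same multiple of a power of 3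
   to both values. *)
have [->|] := eqVneq (size u) (size v); lia.
Qed.

Lemma wlt_catr w u v : wlt u v -> wlt (u ++ w) (v ++ w).
Proof.
rewrite /wlt /wtlt !nonz_cat !num_cat !size_cat.
have : 0 < 3 ^ size w by rewrite expn_gt0.
move: (3 ^ _) => e e0.
have : num u < num v -> num u * e + num w < num v * e + num w.
  by move=> lt; rewrite ltn_add2r ltn_pmul2r.
lia.
Qed.

Lemma wlt_max (T : eqType) (s : seq T) (F : T -> seq 'I_3) :
  injective F -> s != [::] ->
  exists2 t, t \in s & {in s, forall t', t' != t -> wlt (F t') (F t)}.
Proof.
move=> injF; elim: s => // a [|b s] IHs _.
  exists a; rewrite ?mem_head // => w'; rewrite inE => /eqP->.
  by rewrite eqxx.
have [//|w ws wmax] := IHs.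
have [->|neq] := eqVneq a w.
  exists w; rewrite ?mem_head // => w'; rewrite in_cons => /orP[/eqP->|].
    by rewrite eqxx.
  exact: wmax.
have /wlt_total/orP[lt|lt] : F a != F w by apply: contra neq => /eqP/injF/eqP.
  exists w; first by rewrite in_cons ws orbT.
  by move=> w'; rewrite in_cons => /orP[/eqP->//|]; apply: wmax.
exists a; rewrite ?mem_head // => w'; rewrite in_cons => /orP[/eqP->|w's _].
  by rewrite eqxx.
have [->//|neq'] := eqVneq w' w.
exact: wlt_trans (wmax _ w's neq') lt.
Qed.

Lemma wtlt_rot u v : wtlt (u ++ v) (v ++ u) = false.
Proof. by rewrite /wtlt !nonz_cat !size_cat; lia. Qed.

Lemma wlt_letter i u : 0 < nonz u -> 1 < size u -> wlt [:: i] u.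
Proof.
have : nonz [:: i] <= 1 by apply: count_size.
by rewrite /wlt /wtlt /=; lia.
Qed.

(** The top value [3^n - 1] in length [n] belongs to [z^n] alone, so a word with another letter
    stays below it. [wlt_zrot] needs exactly this gap: [3a + 2 < 2 * 3^n + a] amounts to
    [a + 1 < 3^n]. *)
Lemma num_lt_nonz u : 0 < nonz u -> (num u).+1 < 3 ^ size u.
Proof.
elim/last_ind: u => [|u i IHu] //.
rewrite -cats1 nonz_cat num_cat size_cat !addn1 expnSr.
have lu := num_lt u; have [->|ne] := eqVneq i (2%R : 'I_3).
  rewrite (_ : nonz u + _ = nonz u); last by rewrite /nonz /= !addn0.
  by move=> /IHu; rewrite /num /= -/(num u); lia.
have : i < 2 by move: ne (ltn_ord i); rewrite -val_eqE /=; lia.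
by move=> li _; rewrite /num /= -/(num u); lia.
Qed.

Lemma wlt_zrot u : 0 < nonz u -> wlt (u ++ [:: 2%R]) ([:: 2%R] ++ u).
Proof.
move=> /[dup] u0 /num_lt_nonz lt; rewrite /wlt /wtlt.
rewrite !nonz_cat !size_cat !num_cat (_ : num [:: 2%R] = 2) //= ?expn1.
lia.
Qed.

(* the word p(G, z), where letter 0 of p stands for G and letter 1 for z *)
Definition wsubst (G : seq 'I_3) p : seq 'I_3 :=
  flatten [seq if i == 0%R then G else [:: 2%R] | i <- p].

Lemma nonz_wsubst G p : nonz (wsubst G p) = count_mem 0%R p * nonz G.
Proof.
elim: p => //= i p IHw; rewrite /wsubst /= nonz_cat -/(wsubst _ _) IHw mulnDl.
by case: (i == 0%R); rewrite ?mul1n.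
Qed.

Lemma size_wsubst G p :
  size (wsubst G p) = count_mem 0%R p * size G + (size p - count_mem 0%R p).
Proof.
elim: p => //= i p IHw; rewrite /wsubst /= size_cat -/(wsubst _ _) IHw.
have := count_size (pred1 0%R) p; case: (i == 0%R) => /=; lia.
Qed.

(** Only letters z precede the first [0] of [p], so the first letter of [wsubst G p] other than z
    lies in the first copy of [G], at or after its position in [G]. *)
Lemma find_wsubst G p : 0 < nonz G -> 0%R \in p ->
  find (predC1 (2%R : 'I_3)) G <= find (predC1 (2%R : 'I_3)) (wsubst G p).
Proof.
move=> G0; elim: p => //= i p IHw.
rewrite in_cons /wsubst /= -/(wsubst _ _) find_cat has_count.
case: (eqVneq i 0%R) => _ /=; first by rewrite -/(nonz G) G0.
by move=> /IHw; lia.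
Qed.

Lemma wsubst_inj G : 0 < nonz G -> injective (wsubst G).
Proof.
move=> G0.
(* At the first difference one word starts with [0], the other with z. Counting letters other than z
   shows that the second also contains [0]; its leading z then delays the first copy of [G] by at
   least one place. *)
have aux (i : 'I_2) q r : i != 0%R -> wsubst G (0%R :: q) <> wsubst G (i :: r).
  move=> i0 E; have i0' := negPf i0.
  have tv : 0%R \in r.
    apply: contraT => /count_memPn tv; move: (nonz_wsubst G (i :: r)).
    rewrite -E nonz_wsubst /= i0' tv; lia.
  have := find_wsubst G0 tv.
  have := congr1 (find (predC1 (2%R : 'I_3))) E.
  by rewrite /wsubst /= i0' /= find_cat has_count -/(nonz G) G0; lia.
elim=> [|i q IHq] [|j r] //.
- by move/(congr1 size); rewrite /wsubst /= size_cat; case: ifP => _ /=;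
     case: (G) G0.
- by move/(congr1 size); rewrite /wsubst /= size_cat; case: ifP => _ /=;
     case: (G) G0.
have [->|i0] := eqVneq i 0%R; have [->|j0] := eqVneq j 0%R.
- by move/eqP; rewrite /wsubst /= eqseq_cat // eqxx => /eqP/IHq->.
- by move/(aux _ _ _ j0).
- by move/esym/(aux _ _ _ i0).
rewrite /wsubst /= (negPf i0) (negPf j0) /= => -[/IHq->].
by rewrite (ord2_neq0 i0) (ord2_neq0 j0).
Qed.

(** Two occurrences of [0] raise [nonz]. A single one leaves it equal, but then [p] has a further
    letter z and the length grows. *)
Lemma wtlt_wsubst G p : 0 < nonz G -> 0%R \in p -> p != [:: 0%R] ->
  wtlt G (wsubst G p).
Proof.
move=> G0 tw neq; rewrite /wtlt nonz_wsubst size_wsubst.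
have c0 : 0 < count_mem 0%R p by rewrite -has_count has_pred1.
have [c1|c1] := ltnP 1 (count_mem 0%R p); first by nia.
have c1' : count_mem 0%R p = 1 by lia.
rewrite c1' !mul1n ltnn eqxx /=.
suff : 1 < size p by lia.
move: p tw neq {c0 c1 c1'} => [|i [|j p]] //=.
by rewrite in_cons orbF eq_sym => /eqP->; rewrite eqxx.
Qed.

End WordOrder.

(** * Leading words and their multiplicativity *)

Section LeadingWord.
Context {K : fieldType}.
Local Notation A := (freeAlg K 3).
Local Notation word := {fmonom 'I_3}.
Implicit Types (p q : A) (u v : word).

(** A relation rather than a function: no value has to be chosen for [p = 0], and the leading
    coefficient stays implicit. *)
Definition lead p (w : word) :=
  w \in msupp p /\ {in msupp p, forall v, v != w -> wlt v w}.

Lemma lead_uniq p u v : lead p u -> lead p v -> u = v.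
Proof.
move=> [up ltu] [vp ltv]; apply/eqP; apply: contraT => neq.
have := wlt_trans (ltv _ up neq); rewrite eq_sym in neq.
by move=> /(_ _ (ltu _ vp neq)); rewrite wlt_irr.
Qed.

Lemma lead_monom u : lead << u >> u.
Proof.
rewrite /lead msuppU1; split=> [|v]; rewrite inE // => /eqP->.
by rewrite eqxx.
Qed.

Lemma leadZ c p w : c != 0 -> lead p w -> lead (c *: p) w.
Proof. by rewrite /lead msuppZ => /negPf->. Qed.

Lemma lead_addl p q w : lead p w -> {in msupp q, forall v, wlt v w} ->
  lead (p + q) w.
Proof.
move=> [wp ltw] ltq; split=> [|v].
  rewrite -mcoeff_neq0 mcoeffD (@mcoeff_outdom _ _ q) ?addr0 ?mcoeff_neq0 //.
  by apply/negP => /ltq; rewrite wlt_irr.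
by move/(fsubsetP (msuppD_le _ _)); rewrite inE => /orP[/ltw|/ltq].
Qed.

Lemma lead_lt p u w : lead p u -> wlt u w -> {in msupp p, forall v, wlt v w}.
Proof.
move=> [_ ltu] uw v /ltu lt; have [->//|/lt vu] := eqVneq v u.
exact: wlt_trans vu uw.
Qed.

Lemma wlt_mul u u' v v' : (u == u') || wlt u u' -> (v == v') || wlt v v' ->
  [|| (u == u') && (v == v') | wlt (mmul u v) (mmul u' v')].
Proof.
rewrite !fmM => /orP[/eqP->|lt] /orP[/eqP->|lt'].
- by rewrite !eqxx.
- by rewrite wlt_catl ?orbT.
- by rewrite wlt_catr ?orbT.
- by rewrite (wlt_trans (wlt_catr _ lt) (wlt_catl _ lt')) orbT.
Qed.

(** Any pair of words other than [(u, v)] gives a strictly smaller product, so the coefficient of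
    [mmul u v] is the product of the two leading coefficients, nonzero over a field. *)
Lemma leadM p q u v : lead p u -> lead q v -> lead (p * q) (mmul u v).
Proof.
move=> [up ltu] [vq ltv].
have le k l : k \in msupp p -> l \in msupp q ->
    [|| (k == u) && (l == v) | wlt (mmul k l) (mmul u v)].
  move=> kp lq; apply: wlt_mul.
    by have [//|/(ltu _ kp)->] := eqVneq k u.
  by have [//|/(ltv _ lq)->] := eqVneq l v.
split; last first.
  move=> w /msuppM_le [k1 [k2 [kp lq ->]]] neq.
  have /orP[/andP[/eqP k1u /eqP k2v]|//] := le _ _ kp lq.
  by rewrite k1u k2v eqxx in neq.
have neq k l : k \in msupp p -> l \in msupp q -> (k != u) || (l != v) ->
    ((mmul k l) == (mmul u v)) = false.
  move=> kp lq; rewrite -negb_and => /negPf kl; apply/negP => /eqP E.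
  by have := le _ _ kp lq; rewrite kl E wlt_irr.
rewrite -mcoeff_neq0 mcoeffMl (bigD1_seq u) ?fset_uniq //=.
rewrite (bigD1_seq v) ?fset_uniq //= eqxx mulr1n.
rewrite big_seq_cond big1 ?addr0; last first.
  by move=> l /andP[lq lv]; rewrite neq ?lv ?orbT.
rewrite big_seq_cond big1 ?addr0 ?mulf_neq0 ?mcoeff_neq0 //.
move=> k /andP[kp ku]; rewrite big_seq big1 // => l lq.
by rewrite neq ?ku.
Qed.

Lemma lead_word_eval g G (w : {fmonom 'I_2}) : lead g G ->
  lead (word_eval [tuple g; vz] w) (FMonom (wsubst G w)).
Proof.
move=> gG; rewrite /word_eval; case: w => /= w.
elim: w => [|i w IHw].
  rewrite big_nil (_ : FMonom _ = mone); first exact: lead_monom.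
  by apply: val_inj; rewrite /= fm1.
rewrite big_cons (_ : FMonom _ =
  mmul (FMonom (if i == 0 then (G : seq _) else [:: 2])) (FMonom (wsubst G w))).
  apply: leadM => //; case: (eqVneq i 0) => [->|i0]; first by rewrite fmK.
  by rewrite (ord2_neq0 i0) -fmuE; apply: lead_monom.
by apply: val_inj; rewrite /= fmM.
Qed.

(* [lead g G] with a letter other than z in G makes g and z free generators,
   because [wsubst G] is then injective on words. *)
Lemma lead_subst g G (p : freeAlg K 2) : lead g G -> (0 < nonz G)%N -> p != 0 ->
  exists w : {fmonom 'I_2}, [/\ w \in msupp p,
      lead (subst [tuple g; vz] p) (FMonom (wsubst G w))
    & {in msupp p, forall w', w' != w -> wlt (wsubst G w') (wsubst G w)}].
Proof.
move=> gG G0 p0.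
have [||w wp wmax] :=
    @wlt_max _ (msupp p) (fun w : {fmonom 'I_2} => wsubst G w).
- by move=> w w' /(wsubst_inj G0)/val_inj.
- apply: contraNneq p0 => E; rewrite -msupp_eq0; apply/eqP/fsetP => w.
  by rewrite -[w \in msupp p]/(w \in enum_fset (msupp p)) E.
exists w; split=> //; rewrite /subst mmapE.
under eq_bigr do rewrite mul_malgC.
rewrite (bigD1_seq w) ?fset_uniq //=; apply: lead_addl.
  by apply: leadZ; [rewrite mcoeff_neq0|apply: lead_word_eval].
rewrite big_seq_cond; elim/big_ind: _ => [v|a b IHa IHb v|w' /andP[w'p neq] v].
- by rewrite msupp0.
- by move/(fsubsetP (msuppD_le _ _)); rewrite inE => /orP[/IHa|/IHb].
move/(fsubsetP (msuppZ_le _ _)).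
by apply: lead_lt (lead_word_eval _ gG) _ v; apply: wmax.
Qed.

(** The word [w0] already yields a word of larger weight than [G], and the leading word is at least
    that one. *)
Lemma lead_subst_growth g G (p : freeAlg K 2) (w0 : {fmonom 'I_2}) :
    lead g G -> (0 < nonz G)%N ->
    w0 \in msupp p -> 0 \in (w0 : seq 'I_2) -> w0 != fmu 0 ->
  exists2 F, lead (subst [tuple g; vz] p) F & wtlt G F.
Proof.
move=> gG G0 w0p tw0 w0t.
have [|w [wp wl wmax]] := lead_subst gG G0 (p := p).
  by apply: contraTneq w0p => ->; rewrite msupp0.
exists (FMonom (wsubst G w)) => //=.
have : wtlt G (wsubst G w0).
  by apply: wtlt_wsubst => //; apply: contra w0t => /eqP E; rewrite fmuE fmP E.
have [->//|/(wmax _ w0p)] := eqVneq w0 w.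
by rewrite /wlt /wtlt; lia.
Qed.

End LeadingWord.

(** * Substitution and algebra morphisms *)

Section Substitution.
Context {K : fieldType}.

Lemma lrmorph_subst m n n' (psi : {lrmorphism freeAlg K n -> freeAlg K n'})
    (s : m.-tuple (freeAlg K n)) p :
  psi (subst s p) = subst (map_tuple psi s) p.
Proof.
rewrite /subst !mmapE raddf_sum; apply: eq_bigr => w _ /=.
rewrite !mul_malgC linearZ /= rmorph_prod; congr (_ *: _).
by apply: eq_bigr => i _; rewrite tnth_map.
Qed.

Lemma lrmorph_subst2 n n' (psi : {lrmorphism freeAlg K n -> freeAlg K n'})
    f g f' g' p : psi f = f' -> psi g = g' ->
  psi (subst [tuple f; g] p) = subst [tuple f'; g'] p.
Proof.
by move=> <- <-; rewrite lrmorph_subst; congr (subst _ p); apply: val_inj.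
Qed.

Lemma lrmorph_id n (psi : {lrmorphism freeAlg K n -> freeAlg K n}) :
  (forall i, psi (genvar i) = genvar i) -> psi =1 id.
Proof.
move=> psi_gen.
have psi_word (w : seq 'I_n) : psi << FMonom w >> = << FMonom w >>.
  elim: w => [|i w IHw].
    rewrite (_ : FMonom _ = mone) ?rmorph1 //.
    by apply: val_inj; rewrite /= fm1.
  have -> : << FMonom (i :: w) >> = genvar i * << FMonom w >> :> freeAlg K n.
    rewrite /genvar malgM_def fgmulUU mulr1; congr << _ *g _ >>.
    by apply: val_inj; rewrite /= fmM fmU.
  by rewrite rmorphM /= IHw psi_gen.
move=> p; rewrite [p in RHS]monalgE [p in LHS]monalgE raddf_sum.
apply: eq_bigr => w _ /=.
have -> : << p@_w *g w >> = p@_w *: << w >> :> freeAlg K n.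
  by rewrite -mul_malgC malgM_def fgmulUU mulr1 mul1m.
by rewrite linearZ /=; case: (w) => w'; rewrite psi_word.
Qed.

End Substitution.

(** * The subalgebras K<g, z> *)

Section GeneratedSubalgebra.
Context {K : fieldType}.
Local Notation A := (freeAlg K 3).
Local Notation endo := {lrmorphism A -> A}.
Implicit Types (f g q u : A).

(* u lies in K<g, z>; in particular [inalg 0 u] says that u lies in K[z] *)
Definition inalg g u := exists p, u = subst [tuple g; vz] p.

Lemma inalgD g u v : inalg g u -> inalg g v -> inalg g (u + v).
Proof. by move=> [p ->] [p' ->]; exists (p + p'); rewrite rmorphD. Qed.

Lemma inalgZ g c u : inalg g u -> inalg g (c *: u).
Proof. by move=> [p ->]; exists (c *: p); rewrite linearZ. Qed.

Lemma inalgM g u v : inalg g u -> inalg g v -> inalg g (u * v).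
Proof. by move=> [p ->] [p' ->]; exists (p * p'); rewrite rmorphM. Qed.

Lemma inalg0 g : inalg g 0.
Proof. by exists 0; rewrite rmorph0. Qed.

Lemma inalg1 g : inalg g 1.
Proof. by exists 1; rewrite rmorph1. Qed.

Lemma inalg_id g : inalg g g.
Proof. by exists (genvar 0); rewrite subst_genvar. Qed.

Lemma inalg_vz g : inalg g vz.
Proof. by exists (genvar 1); rewrite subst_genvar. Qed.

Lemma inalg_trans g g' u : inalg g g' -> inalg g' u -> inalg g u.
Proof.
move=> [r Er] [p ->]; exists (subst [tuple r; genvar 1] p).
have Ez : subst [tuple g; vz] (genvar 1) = vz by rewrite subst_genvar.
exact: esym
  (@lrmorph_subst2 _ _ _ (subst [tuple g; vz]) _ _ _ _ p (esym Er) Ez).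
Qed.

Lemma inalg_lrmorph (psi : endo) g u : psi vz = vz ->
  inalg g u -> inalg (psi g) (psi u).
Proof. by move=> psiz [p ->]; exists p; apply: lrmorph_subst2. Qed.

Lemma inalg_horner g (r : {poly K}) : inalg g (map_poly (in_alg A) r).[vz].
Proof.
rewrite horner_coef; elim/big_ind: _ => [|u v|i _].
- exact: inalg0.
- exact: inalgD.
apply: inalgM; first by rewrite coef_map /=; apply/inalgZ/inalg1.
elim: (i : nat) => [|k IHk]; first exact: inalg1.
by rewrite exprS; apply: inalgM IHk; apply: inalg_vz.
Qed.

Lemma nonz_Kz q v : inalg 0 q -> v \in msupp q -> nonz v = 0%N.
Proof.
move=> [p ->]; rewrite /subst mmapE.
elim/big_ind: _ v => [v|a b IHa IHb v|w _ v].
- by rewrite msupp0.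
- by move/(fsubsetP (msuppD_le _ _)); rewrite inE => /orP[/IHa|/IHb].
rewrite mul_malgC => /(fsubsetP (msuppZ_le _ _)).
rewrite /word_eval; elim/big_ind: _ v => [v|a b IHa IHb v|i _ v].
- by rewrite msuppU1 inE => /eqP->; rewrite fm1.
- by move=> /msuppM_le [k [l [/IHa k0 /IHb l0 ->]]]; rewrite fmM nonz_cat k0 l0.
have [->|i0] := eqVneq i 0; first by rewrite msupp0.
by rewrite (ord2_neq0 i0) msuppU1 inE => /eqP->; rewrite fmU.
Qed.

Lemma subst_linear g (p : freeAlg K 2) :
  {in msupp p, forall w : {fmonom 'I_2}, 0 \in (w : seq _) -> w = fmu 0} ->
  exists2 q, inalg 0 q & subst [tuple g; vz] p = p@_(fmu 0) *: g + q.
Proof.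
move=> plin; pose p' := p - p@_(fmu 0) *: genvar 0.
exists (subst [tuple 0; vz] p'); first by exists p'.
have Ep (phi : {lrmorphism freeAlg K 2 -> A}) :
    phi p = p@_(fmu 0) *: phi (genvar 0) + phi p'.
  by rewrite /p' linearB linearZ addrC subrK.
have Eg : subst [tuple g; vz] (genvar 0) = g by rewrite subst_genvar.
(* No word of [p'] contains letter 0, so replacing [g] by 0 does not change the value. *)
have Ep' : subst [tuple g; vz] p' = subst [tuple 0; vz] p'.
  rewrite /subst !mmapE; apply: eq_big_seq => w wp'; congr (_ * _).
  have tw : 0 \notin (w : seq _).
    apply/negP => tw; move: wp'; rewrite -mcoeff_neq0 mcoeffB mcoeffZ mcoeffU.
    have [<-|neq] := eqVneq (fmu 0) w; first by rewrite mulr1 subrr eqxx.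
    rewrite mulr0 subr0 mcoeff_neq0 => /plin/(_ tw) E.
    by rewrite E eqxx in neq.
  apply: eq_big_seq => i iw; have i0 : i != 0 by apply: contraNneq tw => <-.
  by rewrite (ord2_neq0 i0).
by have := Ep (subst [tuple g; vz]); rewrite /= Eg Ep'.
Qed.

End GeneratedSubalgebra.

(** * Affine and triangular operations on pairs, and reduced sequences of them *)

Section ElementaryOperations.
Context {K : fieldType} {V : lmodType K} (gen : V -> V -> Prop).
Hypothesis gen0 : forall g, gen g 0.
Hypothesis gen_id : forall g, gen g g.
Hypothesis genD : forall g u v, gen g u -> gen g v -> gen g (u + v).
Hypothesis genZ : forall g (c : K) u, gen g u -> gen g (c *: u).
Hypothesis gen_trans : forall g h u, gen g h -> gen h u -> gen g u.
Implicit Types f g q u : V.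

(* In the application V is K<x,y,z> and [gen g u] means that u lies in K<g, z>,
   so that [gen 0] is K[z]. [opA f g f' g'] and [opB f g f' g'] say that
   (f', g') is obtained from (f, g) by right composition with an affine, resp.
   triangular, automorphism; opA allows translations by elements of K[z], so
   that the two groups meet in the upper triangular affine maps. *)
Definition opA_with (c : K) f g f' g' := exists a b d q r,
  [/\ a * d - b * c != 0, gen 0 q, gen 0 r,
      f' = a *: f + b *: g + q & g' = c *: f + d *: g + r].

Definition opA f g f' g' := exists c, opA_with c f g f' g'.

Definition opA_strict f g f' g' := exists2 c, c != 0 & opA_with c f g f' g'.

Definition opB_with u f g f' g' := exists a b q,
  [/\ a != 0, b != 0, gen 0 q, f' = a *: f + u & g' = b *: g + q].

Definition opB f g f' g' := exists2 u, gen g u & opB_with u f g f' g'.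

(** These are the [u] for which a triangular step is already affine. [opB_strict] excludes them, as
    [opA_strict] excludes [c = 0], where an affine step is already triangular. *)
Definition affine_in g u := exists c q, gen 0 q /\ u = c *: g + q.

Definition opB_strict f g f' g' :=
  exists2 u, gen g u /\ ~ affine_in g u & opB_with u f g f' g'.

Lemma gen_const g q : gen 0 q -> gen g q.
Proof. exact: gen_trans (gen0 g). Qed.

Lemma gen_affine g c q : gen 0 q -> gen g (c *: g + q).
Proof.
by move=> qz; apply: genD; [apply/genZ/gen_id|apply: gen_const].
Qed.

Lemma opA_strictness f g f' g' :
  opA f g f' g' -> opA_strict f g f' g' \/ opB f g f' g'.
Proof.
move=> [c]; have [->|c0 opc] := eqVneq c 0; last by left; exists c.
move=> [a [b [d [q [r [det qz rz -> ->]]]]]]; right.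
exists (b *: g + q); first exact: gen_affine.
exists a, d, r; rewrite addrA scale0r add0r.
by move: det; rewrite mulr0 subr0 mulf_eq0 negb_or => /andP[].
Qed.

Lemma opB_strictness f g f' g' :
  opB f g f' g' -> opB_strict f g f' g' \/ opA f g f' g'.
Proof.
move=> [u ug opu]; have [uaff|] := pselect (affine_in g u); last first.
  by left; exists u.
right; case: uaff opu => [b [r [rz ->]]] [a [d [q [a0 d0 qz -> ->]]]].
exists 0, a, b, d, r, q; rewrite addrA scale0r add0r.
by rewrite mulr0 subr0 mulf_neq0.
Qed.

Lemma opA_sym f g f' g' : opA f g f' g' -> opA f' g' f g.
Proof.
move=> [c [a [b [d [q [r [det qz rz -> ->]]]]]]].
pose D := a * d - b * c.
(* The inverse of the matrix with rows [(a, b)] and [(c, d)], its entries listed in the order c, a,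
   b, d. *)
exists (- c / D), (d / D), (- b / D), (a / D).
exists (- (d / D) *: q + - (- b / D) *: r), (- (- c / D) *: q + - (a / D) *: r).
have comb (s t : K) : s *: (a *: f + b *: g + q) + t *: (c *: f + d *: g + r) +
    (- s *: q + - t *: r) = (s * a + t * c) *: f + (s * b + t * d) *: g.
  rewrite !scalerDr !scalerA !scaleNr !addrA (ACl (1*4*2*5*3*7*6*8)) /=.
  by rewrite addrK addrK -!scalerDl -addrA -scalerDl.
split.
- suff -> : d / D * (a / D) - - b / D * (- c / D) = D^-1 by rewrite invr_eq0.
  by rewrite /D; field.
- by apply: genD; apply: genZ.
- by apply: genD; apply: genZ.
- rewrite comb.
  have -> : d / D * a + - b / D * c = 1 by rewrite /D; field.
  have -> : d / D * b + - b / D * d = 0 by rewrite /D; field.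
  by rewrite scale1r scale0r addr0.
- rewrite comb.
  have -> : - c / D * a + a / D * c = 0 by rewrite /D; field.
  have -> : - c / D * b + a / D * d = 1 by rewrite /D; field.
  by rewrite scale1r scale0r add0r.
Qed.

Lemma opA_trans f g f' g' f'' g'' :
  opA f g f' g' -> opA f' g' f'' g'' -> opA f g f'' g''.
Proof.
move=> [c [a [b [d [q [r [det qz rz -> ->]]]]]]].
move=> [c' [a' [b' [d' [q' [r' [det' qz' rz' -> ->]]]]]]].
have comb (s t : K) u : s *: (a *: f + b *: g + q) + t *: (c *: f + d *: g + r)
    + u = (s * a + t * c) *: f + (s * b + t * d) *: g + (s *: q + t *: r + u).
  by rewrite !scalerDr !scalerA !scalerDl !addrA (ACl (1*4*2*5*3*6*7)).
exists (c' * a + d' * c).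
exists (a' * a + b' * c), (a' * b + b' * d), (c' * b + d' * d).
exists (a' *: q + b' *: r + q'), (c' *: q + d' *: r + r').
split=> //.
- suff -> : (a' * a + b' * c) * (c' * b + d' * d) -
      (a' * b + b' * d) * (c' * a + d' * c) =
      (a' * d' - b' * c') * (a * d - b * c) by rewrite mulf_neq0.
  by ring.
- by apply: genD => //; apply: genD; apply: genZ.
- by apply: genD => //; apply: genD; apply: genZ.
Qed.

(** Solving [g' = b *: g + q] for [g] shows that whatever [g] generates is also generated by [g'];
    hence the inverse step may add [- a^-1 *: u]. *)
Lemma opB_sym f g f' g' : opB f g f' g' -> opB f' g' f g.
Proof.
move=> [u ug [a [b [q [a0 b0 qz -> ->]]]]].
have Eg : g = b^-1 *: (b *: g + q) + (- b^-1) *: q.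
  by rewrite scalerDr scalerA mulVf // scale1r scaleNr addrK.
exists ((- a^-1) *: u).
  apply/genZ/(gen_trans _ ug); rewrite [X in gen _ X]Eg.
  exact/gen_affine/genZ.
exists a^-1, b^-1, ((- b^-1) *: q); rewrite -Eg.
split; rewrite ?invr_eq0 //; first exact: genZ.
by rewrite scalerDr scalerA mulVf // scale1r scaleNr addrK.
Qed.

Lemma opB_trans f g f' g' f'' g'' :
  opB f g f' g' -> opB f' g' f'' g'' -> opB f g f'' g''.
Proof.
move=> [u ug [a [b [q [a0 b0 qz -> ->]]]]].
move=> [u' ug' [a' [b' [q' [a0' b0' qz' -> ->]]]]].
exists (a' *: u + u').
  apply: genD; first exact: genZ.
  by apply: gen_trans ug'; apply: gen_affine.
exists (a' * a), (b' * b), (b' *: q + q').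
split; rewrite ?mulf_neq0 // ?scalerDr ?scalerA ?addrA //.
by apply: genD => //; apply: genZ.
Qed.

Variables x y : V.

(* Pairs obtained from (x, y) by an alternating sequence of operations; the
   boolean tells whether the last one is an opA. *)
Inductive reduced : bool -> V -> V -> Prop :=
| reduced_base f g : opA x y f g -> reduced true f g
| reduced_A f g f' g' :
    reduced false f g -> opA_strict f g f' g' -> reduced true f' g'
| reduced_B f g f' g' :
    reduced true f g -> opB_strict f g f' g' -> reduced false f' g'.

(** Two consecutive operations of the same kind compose to one. If the composite is strict, it
    replaces the last step; otherwise it is also of the other kind and is merged, by induction, with
    the step before. *)
Lemma reduced_merge t f g : reduced t f g -> forall f' g',
  (if t then opA f g f' g' else opB f g f' g') -> exists t', reduced t' f' g'.
Proof.
elim=> {t f g} [f g op0|f g f1 g1 red IH [c _ opc]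
  |f g f1 g1 red IH [u [ug _] opu]].
- by move=> f' g' /(opA_trans op0) ?; exists true; apply: reduced_base.
- move=> f' g' /(opA_trans (ex_intro _ c opc)).
  by case/opA_strictness => [/(reduced_A red)|/IH//]; exists true.
- move=> f' g' /(opB_trans (ex_intro2 _ _ u ug opu)).
  by case/opB_strictness => [/(reduced_B red)|/IH//]; exists false.
Qed.

Definition reducible f g := exists t, reduced t f g.

Lemma reducible_base : reducible x y.
Proof.
exists true; apply: reduced_base; exists 0, 1, 0, 1, 0, 0.
rewrite !scale1r !scale0r !addr0 add0r mulr1 mul0r subr0 oner_neq0.
by split.
Qed.

Lemma reducible_opA f g f' g' :
  opA f g f' g' -> reducible f g <-> reducible f' g'.
Proof.
(* Operations are reversible, so one implication suffices. *)
suff imp f1 g1 f2 g2 : opA f1 g1 f2 g2 -> reducible f1 g1 -> reducible f2 g2.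
  by move=> op; split; apply: imp => //; apply: opA_sym.
move=> op [[] red]; first exact: reduced_merge red _ _ op.
case/opA_strictness: op => [/(reduced_A red)|]; first by exists true.
exact: reduced_merge red _ _.
Qed.

Lemma reducible_opB f g f' g' :
  opB f g f' g' -> reducible f g <-> reducible f' g'.
Proof.
suff imp f1 g1 f2 g2 : opB f1 g1 f2 g2 -> reducible f1 g1 -> reducible f2 g2.
  by move=> op; split; apply: imp => //; apply: opB_sym.
move=> op [[] red]; last exact: reduced_merge red _ _ op.
case/opB_strictness: op => [/(reduced_B red)|]; first by exists false.
exact: reduced_merge red _ _.
Qed.

End ElementaryOperations.

(** * Leading words along reduced sequences *)

Section LeadingWordsOfPairs.
Context {K : fieldType}.
Local Notation A := (freeAlg K 3).
Implicit Types (f g q u : A) (F G : {fmonom 'I_3}).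

(** If letter 0 occurred in [p] only as the one-letter word, [u] would be affine in [g]; so some
    word of [p] makes the weight grow. *)
Lemma lead_nonaffine g G u : lead g G -> (0 < nonz G)%N ->
  inalg g u -> ~ affine_in inalg g u -> exists2 U, lead u U & wtlt G U.
Proof.
move=> gG G0 [p Eu] naff; pose P (w : {fmonom 'I_2}) :=
  (0 \in (w : seq 'I_2)) && (w != fmu 0).
have [/hasP[w wp /andP[tw neq]]|/hasPn plin] := boolP (has P (msupp p)).
  by rewrite Eu; apply: lead_subst_growth wp tw neq.
case: naff; have [w wp tw|q qz Ep] := @subst_linear _ g p.
  by apply/eqP; move: (plin _ wp); rewrite /P tw negbK.
by exists p@_(fmu 0), q; split; [exact: qz|rewrite Eu].
Qed.

Lemma lead_addKz f q F : lead f F -> (0 < nonz F)%N -> inalg 0 q ->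
  lead (f + q) F.
Proof.
move=> fF F0 qz; apply: lead_addl => // v /(nonz_Kz qz) v0.
by rewrite /wlt /wtlt v0 F0.
Qed.

Lemma lead_linear (a b : K) q : (a != 0) || (b != 0) -> inalg 0 q ->
  exists F, [/\ lead (a *: vx + b *: vy + q) F, size F = 1%N & nonz F = 1%N].
Proof.
have [->|b0] := eqVneq b 0 => ab qz.
  exists (fmu 0); rewrite fmU scale0r addr0; split=> //.
  apply: lead_addKz => //; last by rewrite fmU.
  by apply: leadZ; [rewrite orbF in ab|apply: lead_monom].
exists (fmu 1); rewrite fmU; split=> //.
apply: lead_addKz => //; last by rewrite fmU.
rewrite addrC; apply: lead_addl; first by apply/leadZ/lead_monom.
move=> v /(fsubsetP (msuppZ_le _ _)); rewrite msuppU1 inE => /eqP->.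
by rewrite !fmU.
Qed.

Lemma lead_comb (a b : K) f g F G : lead f F -> lead g G -> wlt G F -> a != 0 ->
  lead (a *: f + b *: g) F.
Proof.
move=> fF gG lt a0; apply: lead_addl; first exact: leadZ.
by move=> v /(fsubsetP (msuppZ_le _ _)); apply: lead_lt gG lt v.
Qed.

(** A triangular step builds only on the comparison of weights; the finer bound by [wlt] is what
    later excludes [sigma h]. The alternative [size G <= 1] covers the base, where x may lead [g]
    while y leads [f]. *)
Lemma reduced_lead t f g : reduced inalg vx vy t f g -> exists F G,
  [/\ lead f F, lead g G, (0 < nonz G)%N &
    if t then ~~ wtlt G F && ((size G <= 1)%N || ~~ wlt G F) else wtlt G F].
Proof.
elim=> {t f g} [f g [c [a [b [d [q [r [det qz rz Ef Eg]]]]]]]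
  |f g f' g' _|f g f' g' _].
- have [|F [fF F1 F0]] := lead_linear (a := a) (b := b) _ qz.
    by rewrite -negb_and; apply: contra det => /andP[/eqP-> /eqP->];
       rewrite !mul0r subrr.
  have [|G [gG G1 G0]] := lead_linear (a := c) (b := d) _ rz.
    by rewrite -negb_and; apply: contra det => /andP[/eqP-> /eqP->];
       rewrite !mulr0 subrr.
  by exists F, G; rewrite Ef Eg /wtlt F1 G1 F0 G0; split.
- move=> [F [G [fF gG G0 lt]]] [c c0 [a [b [d [q [r [det qz rz Ef Eg]]]]]]].
  have lt' : wlt G F by rewrite /wlt lt.
  have F0 : (0 < nonz F)%N by move: lt; rewrite /wtlt; lia.
  have gF : lead g' F.
    by rewrite Eg; apply: lead_addKz (lead_comb d fF gG lt' c0) F0 rz.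
  (* Since [c != 0], [F] leads [g']. If [a != 0] it leads [f'] as well; otherwise the determinant
     forces [b != 0], and the smaller [G] leads [f']. *)
  have [a0|a0] := eqVneq a 0; last first.
    exists F, F; rewrite wlt_irr /wtlt; split; [|exact: gF|exact: F0|lia].
    by rewrite Ef; apply: lead_addKz (lead_comb b fF gG lt' a0) F0 qz.
  exists G, F; split;
    [|exact: gF|exact: F0|by move: lt; rewrite /wlt /wtlt; lia].
  have b0 : b != 0 by apply: contraNneq det => ->; rewrite a0 !mul0r subrr.
  by rewrite Ef a0 scale0r add0r; apply: lead_addKz (leadZ b0 gG) G0 qz.
- move=> [F [G [fF gG G0 /andP[lt _]]]].
  move=> [u [ug naff] [a [b [q [a0 b0 qz Ef Eg]]]]].
  have [U uU ltU] := lead_nonaffine gG G0 ug naff.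
  exists U, G; split; [| |exact: G0|exact: ltU]; last first.
    by rewrite Eg; apply: lead_addKz (leadZ b0 gG) G0 qz.
  (* [F] does not outweigh [G], while [U] does; hence [U] survives in [a *: f + u]. *)
  have FU : wlt F U by move: lt ltU; rewrite /wlt /wtlt; lia.
  rewrite Ef addrC -[u]scale1r.
  by apply: lead_comb uU fF FU (oner_neq0 _).
Qed.

End LeadingWordsOfPairs.

(** * Tame automorphisms preserve reducibility *)

Section Tame.
Context {K : fieldType}.
Local Notation A := (freeAlg K 3).
Local Notation endo := {lrmorphism A -> A}.

Lemma z_endoE (f g : A) :
  [/\ z_endo f g vx = f, z_endo f g vy = g & z_endo f g vz = vz].
Proof. by split; rewrite [LHS]subst_genvar. Qed.

Local Notation reducible := (reducible (@inalg K) vx vy).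

Lemma reducible_affine f g f' g' :
  opA (@inalg K) f g f' g' -> reducible f g <-> reducible f' g'.
Proof.
apply: reducible_opA.
- exact: inalg0.
- exact: inalg_id.
- exact: inalgD.
- exact: inalgZ.
- exact: inalg_trans.
Qed.

Lemma reducible_triangular f g f' g' :
  opB (@inalg K) f g f' g' -> reducible f g <-> reducible f' g'.
Proof.
apply: reducible_opB.
- exact: inalg0.
- exact: inalg_id.
- exact: inalgD.
- exact: inalgZ.
- exact: inalg_trans.
Qed.

Lemma z_affine_opA (a : 'M[K]_2) (c b : 'rV[K]_2) (psi : endo) :
    a \in unitmx -> psi vz = vz ->
  opA (@inalg K) (psi vx) (psi vy)
    (psi (z_affine_map a c b vx)) (psi (z_affine_map a c b vy)).
Proof.
move=> a_unit psiz; have [-> -> _] := z_endoE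
  (a 0 0 *: vx + a 1 0 *: vy + c 0 0 *: vz + (b 0 0)%:A)
  (a 0 1 *: vx + a 1 1 *: vy + c 0 1 *: vz + (b 0 1)%:A).
(* The columns of [a] are the rows of the matrix in [opA_with], whose entry [c] comes first. *)
exists (a 0 1), (a 0 0), (a 1 0), (a 1 1).
exists (c 0 0 *: vz + (b 0 0)%:A), (c 0 1 *: vz + (b 0 1)%:A).
have det : a 0 0 * a 1 1 - a 1 0 * a 0 1 != 0.
  by move: a_unit; rewrite unitmxE unitfE det_mx2.
have affz (s t : K) : inalg 0 (s *: vz + t%:A).
  by apply: inalgD; apply: inalgZ; [apply: inalg_vz|apply: inalg1].
have expand (s t k l : K) : psi (s *: vx + t *: vy + k *: vz + l%:A) =
    s *: psi vx + t *: psi vy + (k *: vz + l%:A).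
  exact: lrmorph_affine.
split; [exact: det|exact: affz|exact: affz|exact: expand|exact: expand].
Qed.

Lemma z_triangular_opB (a1 a2 : K) p1 p2 (psi : endo) :
    a1 != 0 -> a2 != 0 -> psi vz = vz ->
  opB (@inalg K) (psi vx) (psi vy) (psi (z_triangular_map a1 a2 p1 p2 vx))
    (psi (z_triangular_map a1 a2 p1 p2 vy)).
Proof.
move=> a10 a20 psiz; have [-> -> _] := z_endoE
  (a1 *: vx + subst [tuple vy; vz] p1)
  (a2 *: vy + (map_poly (in_alg A) p2).[vz]).
exists (psi (subst [tuple vy; vz] p1)).
  by apply: inalg_lrmorph; [exact: psiz|exists p1].
exists a1, a2, (psi (map_poly (in_alg A) p2).[vz]).
have psiq : inalg (psi 0) (psi (map_poly (in_alg A) p2).[vz]).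
  by apply: inalg_lrmorph; [exact: psiz|exact: inalg_horner].
have expand (s : K) u v : psi (s *: u + v) = s *: psi u + psi v.
  by rewrite linearD linearZ.
rewrite rmorph0 in psiq.
by split; [exact: a10|exact: a20|exact: psiq|exact: expand|exact: expand].
Qed.

(** Right composition with a generator is one operation on the pair. The equivalence for all [psi]
    carries the induction through compositions and inverses: for an inverse, the hypothesis is
    applied to [chi \o psi] and reversed. *)
Lemma tame_reducible (phi : endo) : z_tame phi ->
  phi vz = vz /\ forall psi : endo, psi vz = vz ->
    reducible (psi vx) (psi vy) <-> reducible (psi (phi vx)) (psi (phi vy)).
Proof.
elim=> {phi} [a c b a_unit|a1 a2 p1 p2 a1n0 a2n0|
  |phi psi _ [phiz IHphi] _ [psiz IHpsi]
  |phi psi _ [phiz IH] phiK psiK|phi psi _ [phiz IH] E].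
- split=> [|psi psiz]; first by case: (z_endoE
    (a 0 0 *: vx + a 1 0 *: vy + c 0 0 *: vz + (b 0 0)%:A)
    (a 0 1 *: vx + a 1 1 *: vy + c 0 1 *: vz + (b 0 1)%:A)).
  exact/reducible_affine/z_affine_opA.
- split=> [|psi psiz]; first by case: (z_endoE
    (a1 *: vx + subst [tuple vy; vz] p1)
    (a2 *: vy + (map_poly (in_alg A) p2).[vz])).
  exact/reducible_triangular/z_triangular_opB.
- by [].
- split=> [|chi chiz]; first by rewrite /= psiz.
  have /= E := IHpsi (chi \o phi); rewrite phiz chiz in E.
  exact: iff_trans (IHphi _ chiz) (E erefl).
- have psiz : psi vz = vz by rewrite -[X in psi X]phiz phiK.
  split=> // chi chiz.
  have /= E := IH (chi \o psi); rewrite !phiK psiz chiz in E.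
  exact: iff_sym (E erefl).
- by split=> [|chi chiz]; rewrite -!E //; apply: IH.
Qed.

(** * The automorphism [sigma h]: its inverse and its leading words *)

Lemma sigmaE (h : freeAlg K 2) (h' := subst [tuple vx * vz - vz * vy; vz] h) :
  [/\ sigma h vx = vx + vz * h', sigma h vy = vy + h' * vz & sigma h vz = vz].
Proof. exact: z_endoE. Qed.

Lemma sigmaNK (h : freeAlg K 2) : cancel (sigma h) (sigma (- h)).
Proof.
pose h' : A := subst [tuple vx * vz - vz * vy; vz] h.
have EN : subst [tuple vx * vz - vz * vy; vz] (- h) = - h' by rewrite rmorphN.
have [Ex Ey Ez] := sigmaE h; have [Nx Ny Nz] := sigmaE (- h).
rewrite EN in Nx Ny; rewrite -/h' in Ex Ey.
(* [sigma (- h)] fixes xz - zy and z, hence also [h'], and so undoes both shears. *)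
have Nh' : sigma (- h) h' = h'.
  by apply: lrmorph_subst2; [exact: shear_fix Nx Ny Nz|exact: Nz].
apply: (lrmorph_id (psi := sigma (- h) \o sigma h)) => i.
change (sigma (- h) (sigma h (genvar i)) = genvar i).
have [->|->|->] : [\/ i = 0, i = 1 | i = 2].
  case: i => [[|[|[|//]]] lt3]; [apply: Or31|apply: Or32|apply: Or33];
  exact: val_inj.
- exact: etrans (congr1 _ Ex) (shear_cancell Nx Nz Nh').
- exact: etrans (congr1 _ Ey) (shear_cancelr Ny Nz Nh').
- exact: etrans (congr1 _ Ez) Nz.
Qed.

Lemma sigma_auto (h : freeAlg K 2) : is_z_auto (sigma h).
Proof.
split; first by case: (sigmaE h).
exists (sigma (- h)); first exact: sigmaNK.
by move=> p; rewrite -[h in sigma h]opprK sigmaNK.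
Qed.

(** The words xz and zy have equal weight, and zy wins lexicographically because z is the largest
    letter. *)
Lemma lead_xz_zy : lead (vx * vz - vz * vy : A) (mmul (fmu 2) (fmu 1)).
Proof.
have xz : lead (vx * vz : A) (mmul (fmu 0) (fmu 2)).
  exact: leadM (lead_monom _) (lead_monom _).
have zy : lead (vz * vy : A) (mmul (fmu 2) (fmu 1)).
  exact: leadM (lead_monom _) (lead_monom _).
rewrite addrC -scaleN1r -[vx * vz]scale1r.
apply: lead_comb zy xz _ _; first by rewrite !fmM !fmU.
by rewrite oppr_eq0 oner_neq0.
Qed.

Lemma lead_sigma (h : freeAlg K 2) : (0 < deg_t h)%N ->
  exists2 H : {fmonom 'I_3}, (0 < nonz H)%N &
    lead (sigma h vx) (mmul (fmu 2) H) /\ lead (sigma h vy) (mmul H (fmu 2)).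
Proof.
move=> hdeg; have [w0 w0h tw0] :
    exists2 w0, w0 \in msupp h & (0 < count_mem 0%R (w0 : seq 'I_2))%N.
  apply/hasP; move: hdeg; apply: contraTT => /hasPn h0.
  by rewrite -leqNgt leqn0 /deg_t /deg_in big1_seq // => w /andP[_ /h0];
     rewrite -leqNgt leqn0 => /eqP.
pose zy : {fmonom 'I_3} := mmul (fmu 2) (fmu 1).
have G0 : (0 < nonz zy)%N.
  by rewrite fmM !fmU.
have [|w [wh hH wmax]] := lead_subst lead_xz_zy G0 (p := h).
  by apply: contraTneq w0h => ->; rewrite msupp0.
(* As [w0] contains t, its image has a letter other than z; [H] is at least that image in the order,
   so it has one too. *)
set H := FMonom _ in hH; have H0 : (0 < nonz H)%N.
  have : (0 < nonz (wsubst zy w0))%N.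
    by rewrite nonz_wsubst muln_gt0 tw0.
  have [->//|neq] := eqVneq w0 w.
  have : wlt (wsubst zy w0) (wsubst zy w) by exact: wmax.
  by rewrite /wlt /wtlt -[nonz H]/(nonz (wsubst zy w)); lia.
have [-> -> _] := sigmaE h; exists H => //.
have szH : (0 < size H)%N by apply: leq_trans H0 (count_size _ _).
(* The summands [vx] and [vy] are single letters, below zH and Hz, which have length at least 2. *)
split; rewrite addrC; apply: lead_addl.
- exact: leadM (lead_monom _) hH.
- move=> v; rewrite msuppU1 inE => /eqP->; rewrite fmM !fmU.
  by apply: wlt_letter; rewrite ?nonz_cat ?size_cat /= ?addn_gt0 ?H0 ?orbT.
- exact: leadM hH (lead_monom _).
- move=> v; rewrite msuppU1 inE => /eqP->; rewrite fmM !fmU.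
  by apply: wlt_letter; rewrite ?nonz_cat ?size_cat ?addn1 ?addn_gt0 ?H0.
Qed.

End Tame.

Theorem corollary2p3 (K : fieldType) (h : freeAlg K 2)
  (hdeg : (0 < deg_t h)%N) : z_wild (sigma h).
Proof.
split; first exact: sigma_auto.
move=> /tame_reducible[_ /(_ idfun erefl)[/= red _]].
have [t /reduced_lead[F [G [fF gG G0 FG]]]] :=
  red (reducible_base (@inalg0 K) vx vy).
have [H H0 [fH gH]] := lead_sigma hdeg; move: FG.
(* Now [F] is zH and [G] is Hz. Equal weights refute the triangular case; Hz < zH together with
   length at least 2 refutes the affine one. *)
rewrite (lead_uniq fF fH) (lead_uniq gG gH) !fmM !fmU.
rewrite wlt_zrot // wtlt_rot size_cat addn1 ltnS leqn0 orbF.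
have /lt0n_neq0/negPf-> : (0 < size H)%N.
  exact: leq_trans H0 (count_size _ _).
by case: t.
Qed.
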